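(* Let $K$ be a field, $R=K[x_1,\ldots,x_n]$, and let $I\subset R$ be a monomial ideal which has linear quotients with respect to an order $u_1,\ldots,u_m$ of its minimal set of monomial generators $G(I)$. Let $g\colon M(I)\to G(I)$ be the associated decomposition function, and suppose that $g$ is regular. Let $F$ be the graded minimal free resolution of $R/I$, with $F_0=R$ and, for $i>0$, with homogeneous $R$-basis of $F_i$ given by the symbols $f(\sigma;u)$ with $u\in G(I)$, $\sigma\subset \mathrm{set}(u)$, $|\sigma|=i-1$. Then the chain map $\partial$ of $F$ is given by $$\partial(f(\sigma;u))=-\sum_{t\in\sigma}(-1)^{\alpha(\sigma;t)}x_t f(\sigma\setminus \{t\};u)+\sum_{t\in \sigma}(-1)^{\alpha(\sigma;t)}\frac{x_tu}{g(x_tu)}f(\sigma\setminus \{t\};g(x_tu))\quad\text{if }\sigma\neq\emptyset,$$ and $$\partial(f(\emptyset;u))=u .$$ Here $\alpha(\sigma;t)=|\{s\in\sigma : s<t\}|$. (That is, the graded free modules $F_i$ with these bases and these maps $\partial$ form the graded minimal free resolution of $R/I$.)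
   Context: $G(I)$ denotes the unique minimal set of monomial generators of the monomial ideal $I$, and $M(I)$ the set of all monomials in $I$. The ideal $I$ has linear quotients with respect to the order $u_1,\ldots,u_m$ of the elements of $G(I)$ if for all $j=1,\ldots,m$ the colon ideal $(u_1,\ldots,u_{j-1}):u_j$ is generated by a subset of $\{x_1,\ldots,x_n\}$. For $j=1,\ldots,m$ set $$\mathrm{set}(u_j)=\{k\in\{1,\ldots,n\} : x_k\in (u_1,\ldots,u_{j-1}):u_j\}.$$ Put $I_j=(u_1,\ldots,u_j)$. The decomposition function $g\colon M(I)\to G(I)$ is defined by $g(u)=u_j$, where $j$ is the smallest number such that $u\in I_j$; in this case $g(u)$ divides $u$. The decomposition function $g$ is called regular if $\mathrm{set}(g(x_su))\subset \mathrm{set}(u)$ for all $u\in G(I)$ and all $s\in \mathrm{set}(u)$. The basis element $f(\sigma;u)$ has degree $|\sigma|+\deg u$. By convention, $f(\sigma;u)=0$ whenever $u\in G(I)$ and $\sigma\not\subset \mathrm{set}(u)$. *)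

(* Defs.v *)
From HB Require Import structures.
From mathcomp Require Import all_boot all_order all_algebra.
From mathcomp Require Import boolp.
From mathcomp Require Import mpoly.

Set Implicit Arguments.
Unset Strict Implicit.
Unset Printing Implicit Defensive.

Import GRing.Theory.
Local Open Scope ring_scope.

Definition ideal_gen (R : comNzRingType) (S : R -> Prop) (p : R) : Prop :=
  exists c : seq (R * R),
    (forall x, x \in c -> S x.2) /\ p = \sum_(x <- c) x.1 * x.2.

(* J : a *)
Definition colon (R : comNzRingType) (J : R -> Prop) (a p : R) : Prop :=
  J (p * a).

Definition mon_ideal (K : fieldType) (n : nat) (S : 'X_{1..n} -> Prop) :
    {mpoly K[n]} -> Prop :=
  ideal_gen (fun p => exists2 m, S m & p = 'X_[m]).

Definition var_ideal (K : fieldType) (n : nat) (A : {set 'I_n}) :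
    {mpoly K[n]} -> Prop :=
  ideal_gen (fun p => exists2 k, k \in A & p = 'X_k).

Definition monomial_ideal (K : fieldType) (n : nat) (I : {mpoly K[n]} -> Prop) :
    Prop :=
  exists S : 'X_{1..n} -> Prop, forall p, I p <-> mon_ideal S p.

(* (u_1, ..., u_j), where us lists u_1, ..., u_m *)
Definition initial_ideal (K : fieldType) (n : nat) (us : seq 'X_{1..n})
    (j : nat) : {mpoly K[n]} -> Prop :=
  mon_ideal (fun m => m \in take j us).

(* us enumerates, without repetition, the minimal set G(I) of monomial
   generators of I. *)
Definition enum_min_gens (K : fieldType) (n : nat) (I : {mpoly K[n]} -> Prop)
    (us : seq 'X_{1..n}) : Prop :=
  [/\ uniq us,
      forall p, I p <-> mon_ideal (fun m => m \in us) p
    & forall S : 'X_{1..n} -> Prop,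
        (forall m, S m -> m \in us) ->
        (forall p, I p <-> mon_ideal S p) ->
        forall m, m \in us -> S m].

Definition linear_quotients (K : fieldType) (n : nat) (us : seq 'X_{1..n}) :
    Prop :=
  forall j, (j < size us)%N ->
    exists A : {set 'I_n}, forall p : {mpoly K[n]},
      colon (initial_ideal us j) 'X_[nth 0%MM us j] p <-> var_ideal A p.

(* set(u) for u in us; [index u us] is the 0-based position of u, so the
   generators that precede u are [take (index u us) us]. *)
Definition lqset (K : fieldType) (n : nat) (us : seq 'X_{1..n})
    (u : 'X_{1..n}) : {set 'I_n} :=
  [set k | `[< colon (initial_ideal us (index u us)) ('X_[u] : {mpoly K[n]}) 'X_k >]].

(* The first u_j such that m lies in I_j.  Only meaningful for m in M(I); the
   value is 0%MM otherwise. *)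
Definition decomp (K : fieldType) (n : nat) (us : seq 'X_{1..n})
    (m : 'X_{1..n}) : 'X_{1..n} :=
  nth 0%MM us (find (fun j => `[< initial_ideal us j.+1 ('X_[m] : {mpoly K[n]}) >])
                    (iota 0 (size us))).

Definition regular_decomp (K : fieldType) (n : nat) (us : seq 'X_{1..n}) :
    Prop :=
  forall u, u \in us -> forall s, s \in lqset K us u ->
    lqset K us (decomp K us (U_(s) + u)%MM) \subset lqset K us u.

(* The free module on B; [deg b] is the degree of the basis element b. *)
Definition free_mod (K : fieldType) (n : nat) (B : finType) :
    lmodType {mpoly K[n]} :=
  {ffun B -> {mpoly K[n]}^o}.

Definition fm_coord (K : fieldType) (n : nat) (B : finType) (b : B)
    (v : free_mod K n B) : {mpoly K[n]} :=
  (v : {ffun B -> {mpoly K[n]}^o}) b.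

Definition homog_elt (K : fieldType) (n : nat) (B : finType) (deg : B -> nat)
    (e : nat) (v : free_mod K n B) : Prop :=
  forall b m, m \in msupp (fm_coord b v) -> (mdeg m + deg b)%N = e.

Fact fm_coord_is_linear (K : fieldType) (n : nat) (B : finType) (b : B) :
  linear (fm_coord b : free_mod K n B -> {mpoly K[n]}^o).
Proof. by move=> a v w; rewrite /fm_coord ffunE ffunE. Qed.

HB.instance Definition _ (K : fieldType) (n : nat) (B : finType) (b : B) :=
  GRing.isLinear.Build {mpoly K[n]} (free_mod K n B) {mpoly K[n]}^o _
    (fm_coord b) (@fm_coord_is_linear K n B b).

(* The complex  ... -> F_2 -> F_1 -> F_0,  with F_i free on B i, is a graded
   minimal free resolution of R/I by way of the composite of
   eps : F_0 -> R and the canonical surjection R -> R/I.  Minimality is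
   d(F_(i+1)) \subset (x_1, ..., x_n) F_i, i.e. all coordinates of d v lie in
   (x_1, ..., x_n). *)
Record minimal_graded_free_resolution (K : fieldType) (n : nat)
    (I : {mpoly K[n]} -> Prop)
    (B : nat -> finType) (deg : forall i, B i -> nat)
    (d : forall i, {linear free_mod K n (B i.+1) -> free_mod K n (B i)})
    (eps : {linear free_mod K n (B 0%N) -> {mpoly K[n]}^o}) : Prop :=
  MinimalGradedFreeResolution {
    res_eps_graded : forall e v,
      homog_elt (@deg 0%N) e v -> (eps v : {mpoly K[n]}) \is e.-homog;
    res_d_graded : forall i e v,
      homog_elt (@deg i.+1) e v -> homog_elt (@deg i) e (d i v);
    res_eps_surj : forall p, exists v, I (eps v - p);
    res_exact0 : forall v, I (eps v) <-> exists w, v = d 0%N w;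
    res_exactS : forall i v, d i v = 0 <-> exists w, v = d i.+1 w;
    res_minimal : forall i v b, var_ideal [set: 'I_n] (fm_coord b (d i v))
  }.

(* F_0 = R is free on the single element tt; F_(i+1) is free on the pairs
   (sigma, u) with u in us, sigma \subset set(u) and |sigma| = i. *)
Definition lq_basis (K : fieldType) (n : nat) (us : seq 'X_{1..n}) (i : nat) :
    finType :=
  match i with
  | 0 => unit
  | i'.+1 => {x : {set 'I_n} * seq_sub us |
               (x.1 \subset lqset K us (ssval x.2)) && (#|x.1| == i')}
  end.

Definition lq_deg (K : fieldType) (n : nat) (us : seq 'X_{1..n}) (i : nat) :
    lq_basis K us i -> nat :=
  match i with
  | 0 => fun _ => 0%N
  | i'.+1 => fun b => (#|(val b).1| + mdeg (ssval (val b).2))%N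
  end.

(* f(sigma; u) as an element of F_(i+1).  It is the basis element indexed by
   (sigma, u) if that is in [lq_basis K us i.+1], and 0 otherwise; the latter
   gives the convention f(sigma; u) = 0 for sigma not contained in set(u). *)
Definition lq_symb (K : fieldType) (n : nat) (us : seq 'X_{1..n}) (i : nat)
    (sigma : {set 'I_n}) (u : 'X_{1..n}) : free_mod K n (lq_basis K us i.+1) :=
  [ffun b : lq_basis K us i.+1 =>
     (((val b).1 == sigma) && (ssval (val b).2 == u))%:R].

(* The element of F_0 = R corresponding to p *)
Definition F0_elt (K : fieldType) (n : nat) (us : seq 'X_{1..n})
    (p : {mpoly K[n]}) : free_mod K n (lq_basis K us 0) :=
  [ffun=> p].

Definition alpha (n : nat) (sigma : {set 'I_n}) (t : 'I_n) : nat :=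
  #|[set s in sigma | (s < t)%N]|.

(* Main.v *)
(* Filter the complex F by letting F^(j) be spanned by the f(sigma; u_k) with k <= j. Since
   g(x_t u_j) precedes u_j for t in set(u_j), the quotient F^(j) / F^(j-1) is the Koszul
   complex on the variables x_t, t in set(u_j), up to sign; it is exact in positive degree,
   and in degree 0 its homology R / (x_t : t in set(u_j)) is R / ((u_1, ..., u_(j-1)) : u_j).
   So every cycle of F can be pushed down the filtration by subtracting boundaries. That
   d d = 0 comes from the regularity of g through g(x_s g(x_t u)) = g(x_t g(x_s u)). *)
Require Import Defs.
From HB Require Import structures.
From mathcomp Require Import all_boot all_order all_algebra.
From mathcomp Require Import boolp.
From mathcomp Require Import mpoly.

Set Implicit Arguments.
Unset Strict Implicit.
Unset Printing Implicit Defensive.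

Import GRing.Theory.
Local Open Scope ring_scope.

(** Regularity is needed twice. Besides the commutation rule, d d is computed by applying the
    boundary formula to symbols f(sigma \ t; g(x_t u)), some of which are 0 only by convention. The
    formula may be used on them only if its right side vanishes as well, and this again comes from
    set(g(x_t u)) lying in set(u). For this reason symbols, boundaries and coefficients are defined
    for all pairs (sigma, u), not only for those indexing a basis element. Koszul exactness is
    proved for bare coefficient functions on subsets, by splitting off one variable at a time.
    Minimality rests on two facts about G(I): 1 is not a generator because I is proper, and x_t u is
    not a generator because the generator u properly divides it. *)

(** * Ideals generated by a set *)

Section IdealGen.
Variable R : comNzRingType.
Implicit Types (S T : R -> Prop) (p q : R).

Lemma ideal_gen0 S : ideal_gen S 0.
Proof. by exists [::]; rewrite big_nil. Qed.

Lemma ideal_genD S p q : ideal_gen S p -> ideal_gen S q -> ideal_gen S (p + q).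
Proof.
move=> [c [cS ->]] [c' [c'S ->]]; exists (c ++ c'); split; last by rewrite big_cat.
by move=> x; rewrite mem_cat => /orP[/cS|/c'S].
Qed.

Lemma ideal_genM S p q : S q -> ideal_gen S (p * q).
Proof.
move=> Sq; exists [:: (p, q)]; rewrite big_seq1; split => // x.
by rewrite inE => /eqP ->.
Qed.

Lemma ideal_gen_sum S (I : Type) (r : seq I) (P : pred I) (F : I -> R) :
  (forall i, P i -> ideal_gen S (F i)) -> ideal_gen S (\sum_(i <- r | P i) F i).
Proof.
by move=> SF; elim/big_rec: _ => [|i p Pi]; [apply: ideal_gen0 | apply/ideal_genD/SF].
Qed.

Lemma ideal_gen_ind S (P : R -> Prop) :
    P 0 -> (forall a s q, S s -> P q -> P (a * s + q)) ->
  forall p, ideal_gen S p -> P p.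
Proof.
move=> P0 PD p [c [cS ->]]; elim: c cS => [|x c IHc] cS; first by rewrite big_nil.
rewrite big_cons; apply: PD; first by apply: cS; rewrite mem_head.
by apply: IHc => y yc; apply: cS; rewrite in_cons yc orbT.
Qed.

Lemma ideal_genMl S p q : ideal_gen S q -> ideal_gen S (p * q).
Proof.
elim/ideal_gen_ind => [|a s {}q Ss IHq]; first by rewrite mulr0; apply: ideal_gen0.
by rewrite mulrDr mulrA; apply: ideal_genD IHq; apply: ideal_genM.
Qed.

Lemma eq_ideal_gen S T p :
  (forall q, S q <-> T q) -> ideal_gen S p <-> ideal_gen T p.
Proof. by move=> eqST; split=> -[c [cS ->]]; exists c; split=> // x /cS /eqST. Qed.

End IdealGen.

(** * Monomial ideals, read off supports *)

Section MonomialIdeals.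
Variables (K : fieldType) (n : nat).
Implicit Types (S : 'X_{1..n} -> Prop) (m u : 'X_{1..n}) (p q : {mpoly K[n]}).

(** Multiples of a monomial have only multiples of it in their support, and supports of sums do not
    grow; conversely p is split into its terms. *)
Lemma mon_idealP S p :
  mon_ideal S p <-> forall m, m \in msupp p -> exists2 s, S s & (s <= m)%MM.
Proof.
split.
  elim/ideal_gen_ind => [m|a _ q [s Ss ->] IHq m]; first by rewrite msupp0.
  move/msuppD_le; rewrite mem_cat => /orP[|/IHq//].
  case/msuppM_le/allpairsP => -[m1 m2] /= [_]; rewrite msuppX inE => /eqP -> ->.
  by exists s => //; apply: lem_addl.
move=> pS; rewrite (mpolyE p) big_seq; apply: ideal_gen_sum => m /pS [s Ss le_sm].
rewrite -(submK le_sm) mpolyXD scalerAl.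
by apply: ideal_genM; exists s.
Qed.

Lemma mon_idealX S m :
  mon_ideal S ('X_[m] : {mpoly K[n]}) <-> exists2 s, S s & (s <= m)%MM.
Proof.
split=> [/mon_idealP|Sm]; first by apply; rewrite msuppX mem_head.
by apply/mon_idealP => m'; rewrite msuppX inE => /eqP ->.
Qed.

Lemma mon_idealMX S p u :
  mon_ideal S (p * 'X_[u]) <->
  forall m, m \in msupp p -> exists2 s, S s & (s <= m + u)%MM.
Proof.
split=> [/mon_idealP pS m mp | pS]; last apply/mon_idealP => m.
  by apply: pS; rewrite (perm_mem (msuppMX _ _)) addmC map_f.
by rewrite (perm_mem (msuppMX _ _)) => /mapP [m' /pS + ->]; rewrite addmC.
Qed.

Lemma var_ideal_mon (A : {set 'I_n}) p :
  var_ideal A p <-> mon_ideal (fun m => exists2 k, k \in A & m = U_(k)%MM) p.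
Proof.
apply: eq_ideal_gen => q; split=> [[k kA ->]|[_ [k kA ->] ->]]; last by exists k.
by exists U_(k)%MM => //; exists k.
Qed.

Lemma var_idealP (A : {set 'I_n}) p :
  var_ideal A p <-> forall m, m \in msupp p -> exists2 k, k \in A & (0 < m k)%N.
Proof.
rewrite var_ideal_mon mon_idealP; split=> pA m /pA.
  by move=> [_ [k kA ->]]; rewrite lep1mP -lt0n; exists k.
by move=> [k kA m_gt0]; exists U_(k)%MM; rewrite ?lep1mP -?lt0n //; exists k.
Qed.

Lemma var_idealX (A : {set 'I_n}) m :
  var_ideal A ('X_[m] : {mpoly K[n]}) <-> exists2 k, k \in A & (0 < m k)%N.
Proof.
rewrite var_idealP; split; first by apply; rewrite msuppX mem_head.
by move=> mA m'; rewrite msuppX inE => /eqP ->.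
Qed.

(** Multiplication by x_a changes exponents at a only, and a is not in A. This makes x_a a
    nonzerodivisor modulo (x_t : t in A), as Koszul exactness requires. *)
Lemma var_ideal_prime (A : {set 'I_n}) (a : 'I_n) p :
  a \notin A -> var_ideal A (p * 'X_a) -> var_ideal A p.
Proof.
move=> aA /var_idealP pA; apply/var_idealP => m mp.
case: (pA (U_(a) + m)%MM) => [|k kA]; first by rewrite (perm_mem (msuppMX _ _)) map_f.
rewrite mnmDE mnm1E; case: eqP kA => [<-|_ kA]; first by rewrite (negPf aA).
by exists k.
Qed.

Lemma var_ideal_sum (A : {set 'I_n}) p :
  var_ideal A p -> exists q : 'I_n -> {mpoly K[n]}, p = \sum_(t in A) q t * 'X_t.
Proof.
elim/ideal_gen_ind => [|a _ q [k kA ->] [f ->]].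
  by exists (fun=> 0); rewrite big1 // => t _; rewrite mul0r.
exists (fun t => a * (t == k)%:R + f t).
under [RHS]eq_bigr do rewrite mulrDl.
rewrite big_split /=; congr (_ + _).
rewrite (bigD1 k) //= eqxx mulr1 big1 ?addr0 // => t /andP[_ /negPf ->].
by rewrite mulr0 mul0r.
Qed.

Lemma var_idealX_setT m : m != 0%MM -> var_ideal [set: 'I_n] ('X_[m] : {mpoly K[n]}).
Proof.
move=> m0; apply/var_idealX; move: m0; rewrite -mdeg_eq0 mdegE sum_nat_eq0 negb_forall.
by case/existsP=> k; rewrite -lt0n; exists k.
Qed.

(** If u properly divided w, the generators other than w would still generate I. *)
Lemma min_gens_antichain (I : {mpoly K[n]} -> Prop) (us : seq 'X_{1..n}) :
  enum_min_gens I us ->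
  forall u w, u \in us -> w \in us -> (u <= w)%MM -> u = w.
Proof.
case=> _ Ius us_min u w uus wus uw; apply/eqP/negPn/negP => neq_uw.
have [] : (w \in us) /\ w != w; last by rewrite eqxx.
apply: (us_min (fun m => m \in us /\ m != w)) => // [m []//|p].
rewrite Ius !mon_idealP; split=> pus m /pus [s]; last by case=> sus _; exists s.
move=> sus sm; have [E|sw] := eqVneq s w; last by exists s.
by exists u => //; apply: lepm_trans uw _; rewrite -E.
Qed.

End MonomialIdeals.

(** * The decomposition function and linear quotients *)

Section Decomposition.
Variables (K : fieldType) (n : nat) (us : seq 'X_{1..n}).
Hypotheses (us_uniq : uniq us) (us_lq : linear_quotients K us).
Implicit Types (m u v w : 'X_{1..n}) (s t : 'I_n).

Local Notation g := (decomp K us).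
Local Notation lset := (lqset K us).

Lemma mem_take_index u v :
  u \in us -> v \in us -> (v \in take (index u us) us) = (index v us < index u us)%N.
Proof. by move=> uus vus; rewrite in_take. Qed.

(** Membership of m in an initial ideal only asks whether the first divisor of m in [us] has been
    reached, so the search over ideals becomes a search over generators. *)
Lemma decompE m : g m = nth 0%MM us (find (fun u => (u <= m)%MM) us).
Proof.
congr nth; set P := (fun u => (u <= m)%MM).
have initE j : (j < size us)%N ->
    `[< initial_ideal us j.+1 ('X_[m] : {mpoly K[n]}) >] = (find P us <= j)%N.
  move=> ltj; rewrite -ltnS -has_take_leq //.
  apply/asboolP/hasP => [/mon_idealX|[u uus um]]; first by case=> u; exists u.
  by apply/mon_idealX; exists u.
transitivity (find (leq (find P us)) (iota 0 (size us))).
  by apply: eq_in_find => j; rewrite mem_iota => /initE.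
(* If i = [size us], no generator divides m: the search over [iota] fails too, and both searches
   return [size us]. *)
move: (find P us) (find_size P us) => i; rewrite leq_eqVlt => /orP[/eqP ->|lti].
  rewrite -[RHS](size_iota 0); apply/hasNfind/hasPn => j.
  by rewrite mem_iota -ltnNge.
rewrite -(subnKC (ltnW lti)) iotaD find_cat add0n.
have -> /= : has (leq i) (iota 0 i) = false.
  by apply/hasPn => j; rewrite mem_iota -ltnNge.
move: lti; rewrite size_iota -subn_gt0; case: (size us - i)%N => //= k _.
by rewrite leqnn addn0.
Qed.

Lemma decompP m : (exists2 u, u \in us & (u <= m)%MM) ->
  [/\ g m \in us, (g m <= m)%MM &
      forall u, u \in us -> (u <= m)%MM -> (index (g m) us <= index u us)%N].
Proof.
move=> [u0 u0us u0m]; rewrite decompE.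
have hasm : has (fun u => (u <= m)%MM) us by apply/hasP; exists u0.
split; first by rewrite mem_nth // -has_find.
  by move: (nth_find 0%MM hasm).
move=> u uus um; rewrite index_uniq -?has_find // leqNgt; apply/negP.
by move/(before_find 0%MM); rewrite nth_index // um.
Qed.

Lemma decomp_eq m u : u \in us -> (u <= m)%MM ->
  (forall v, v \in us -> (index v us < index u us)%N -> ~~ (v <= m)%MM) -> g m = u.
Proof.
move=> uus um umin; have [|gus gm gmin] := @decompP m; first by exists u.
have := gmin u uus um; rewrite leq_eqVlt => /orP[/eqP/index_inj->//|].
by move/(umin _ gus); rewrite gm.
Qed.

(** Linear quotients tested on monomials: m lies in the colon ideal at u exactly when some variable
    of set(u) divides it. The set A given by the hypothesis must be set(u), as one sees on single
    variables. All later uses of linear quotients go through this equivalence. *)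
Lemma lqsetP u m : u \in us ->
  (exists2 v, v \in us & (index v us < index u us)%N && (v <= m + u)%MM) <->
  (exists2 k, k \in lset u & (0 < m k)%N).
Proof.
move=> uus; have [|A JA] := us_lq (j := index u us); first by rewrite index_mem.
rewrite nth_index // /colon /initial_ideal in JA.
have lE : lset u = A.
  apply/setP => k; rewrite inE; apply/asboolP/idP => [/JA/var_idealX[j jA]|kA].
    by rewrite mnm1E lt0b => /eqP ->.
  by apply/JA/var_idealX; exists k; rewrite // mnm1E eqxx.
rewrite lE -(var_idealX K) -JA -mpolyXD mon_idealX; split=> -[v].
  by move=> vus /andP[vu vm]; exists v; rewrite ?mem_take_index.
move=> vu vm; have vus := mem_take vu; exists v => //.
by rewrite -mem_take_index // vu.
Qed.

Lemma notin_lqset u m k : u \in us -> k \in lset u ->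
  (forall v, v \in us -> (index v us < index u us)%N -> ~~ (v <= m + u)%MM) -> m k = 0%N.
Proof.
move=> uus ku umin; apply/eqP; rewrite -leqn0 leqNgt; apply/negP => mk.
have [|v vus /andP[vu vm]] := (lqsetP m uus).2; first by exists k.
by have := umin v vus vu; rewrite vm.
Qed.

(** The two cases of the last clause serve different ends: the strict descent for t in set(u) drives
    the filtration, and g(x_t u) = u for the other t makes the two t-terms of the boundary formula
    cancel. *)
Lemma decomp_lqset u t : u \in us ->
  [/\ g (U_(t) + u)%MM \in us, (g (U_(t) + u) <= U_(t) + u)%MM
    & if t \in lset u then (index (g (U_(t) + u)%MM) us < index u us)%N
      else g (U_(t) + u)%MM == u].
Proof.
move=> uus; have [|gus gm gmin] := @decompP (U_(t) + u)%MM.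
  by exists u; rewrite // lem_addl.
split=> //; case: ifPn => [tu|tNu].
  have [|v vus /andP[vu vm]] := (lqsetP U_(t)%MM uus).2.
    by exists t; rewrite // mnm1E eqxx.
  exact: leq_ltn_trans (gmin v vus vm) vu.
apply/eqP/decomp_eq; rewrite ?lem_addl // => v vus vu; apply: contraNN tNu => vm.
have [|k ku] := (lqsetP U_(t)%MM uus).1; first by exists v; rewrite // vu.
by rewrite mnm1E lt0b => /eqP ->.
Qed.

Hypothesis g_regular : regular_decomp K us.

(* Regularity is used through x_s g(w) = g(x_s g(w)) z: the support of w / g(w) avoids
   set(g(w)), hence it also avoids the smaller set(g(x_s g(w))). *)
Lemma decomp_mulU w s : (exists2 u, u \in us & (u <= w)%MM) ->
  g (U_(s) + g w)%MM = g (U_(s) + w)%MM.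
Proof.
move=> wI; have [uus uw umin] := decompP wI.
set u := g w in uus uw umin *; set y := (w - u)%MM.
have yE : w = (y + u)%MM by rewrite submK.
have y0 k : k \in lset u -> y k = 0%N.
  move=> ku; apply: (notin_lqset uus ku) => v vus; rewrite -yE ltnNge.
  by apply: contraNN => /(umin v vus).
have [gus gm Hg] := decomp_lqset s uus.
set l := g (U_(s) + u)%MM in gus gm Hg *; set z := (U_(s) + u - l)%MM.
have zE : (U_(s) + u = z + l)%MM by rewrite submK.
(* Regularity speaks only of s in set(u); for the other s one has l = u. *)
have lu : lset l \subset lset u.
  by case: ifPn Hg => [su _|_ /eqP->//]; apply: g_regular.
have z0 k : k \in lset l -> z k = 0%N.
  move=> kl; apply: (notin_lqset gus kl) => v vus; rewrite -zE ltnNge.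
  by apply: contraNN; have [|_ _] := @decompP (U_(s) + u)%MM; [exists u; rewrite // lem_addl | apply].
(* The cofactor of l in x_s w is z y. Here z avoids set(l) because l = g(x_s u), and y does because
   set(l) lies in set(u); so no generator before l divides x_s w. *)
have wE : (U_(s) + w = z + y + l)%MM.
  by rewrite {1}yE addmA (addmC _ y) -addmA zE addmA (addmC y).
apply/esym/decomp_eq; rewrite // wE ?lem_addl // => v vus vl.
apply/negP => vm; have [|k kl] := (lqsetP (z + y)%MM gus).1.
  by exists v; rewrite // vl.
by rewrite mnmDE z0 // y0 // (subsetP lu).
Qed.

(** Both sides equal g(x_s x_t u). *)
Lemma decomp_swap u s t : u \in us ->
  g (U_(s) + g (U_(t) + u))%MM = g (U_(t) + g (U_(s) + u))%MM.
Proof.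
move=> uus; have uI k : exists2 v, v \in us & (v <= U_(k) + u)%MM.
  by exists u; rewrite // lem_addl.
by rewrite !decomp_mulU // !addmA (addmC U_(s)%MM).
Qed.

End Decomposition.

(** * Koszul signs *)

Section Signs.
Variable n : nat.
Implicit Types (A sigma tau : {set 'I_n}) (s t : 'I_n).

Lemma alphaU1 tau s t : t \notin tau ->
  alpha (t |: tau) s = ((t < s)%N + alpha tau s)%N.
Proof.
move=> tN; rewrite /alpha; have [ts|ts] := ltnP t s; last first.
  rewrite add0n; congr #|pred_of_set _|; apply/setP => k; rewrite !inE.
  by case: eqP => //= ->; rewrite ltnNge ts (negPf tN).
have -> : [set k in t |: tau | (k < s)%N] = t |: [set k in tau | (k < s)%N].
  by apply/setP => k; rewrite !inE; case: eqP => //= ->; rewrite ts.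
by rewrite cardsU1 inE (negPf tN).
Qed.

(** Of the two orders of insertion exactly one counts the element inserted before, so the total
    exponents differ by one. Insertion is the form met by coefficients of a differential; deletion,
    treated next, is the form met in the boundary formula. *)
Lemma signU1_swap (R : pzRingType) tau s t : t \notin tau -> s \notin tau -> s != t ->
  (-1) ^+ alpha tau t * (-1) ^+ alpha (t |: tau) s
    = - ((-1) ^+ alpha tau s * (-1) ^+ alpha (s |: tau) t) :> R.
Proof.
move=> tN sN st; rewrite -!exprD !alphaU1 //.
case: ltngtP st => [_ _|_ _|/val_inj ->]; last by rewrite eqxx.
  by rewrite add0n add1n addnS exprS mulN1r addnC.
by rewrite add0n add1n addnS exprS mulN1r opprK addnC.
Qed.

Lemma signD1_swap (R : pzRingType) sigma s t : t \in sigma -> s \in sigma -> s != t ->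
  (-1) ^+ alpha sigma t * (-1) ^+ alpha (sigma :\ t) s
    = - ((-1) ^+ alpha sigma s * (-1) ^+ alpha (sigma :\ s) t) :> R.
Proof.
move=> ts ss st; set tau := sigma :\ t :\ s.
have tN : t \notin tau by rewrite !inE eqxx andbF.
have sN : s \notin tau by rewrite !inE eqxx.
have tE : sigma :\ t = s |: tau by rewrite setD1K // !inE st.
have sE : sigma :\ s = t |: tau.
  have -> : tau = sigma :\ s :\ t by rewrite /tau setDDl setUC -setDDl.
  by rewrite setD1K // !inE eq_sym st.
have -> : alpha sigma t = ((s < t)%N + alpha tau t)%N.
  by rewrite -(setD1K ts) alphaU1 ?setD11 // ltnn tE alphaU1.
have -> : alpha sigma s = ((t < s)%N + alpha tau s)%N.
  by rewrite -(setD1K ss) alphaU1 ?setD11 // ltnn sE alphaU1.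
rewrite tE sE !alphaU1 // !ltnn !add0n -!exprD.
case: ltngtP st => [_ _|_ _|/val_inj ->]; last by rewrite eqxx.
  by rewrite add0n add1n addSn exprS mulN1r addnC.
by rewrite add0n add1n addSn exprS mulN1r opprK addnC.
Qed.

(** The terms at (t, s) and (s, t) cancel. Splitting at s < t, instead of showing that the sum
    equals its negative, avoids a division by 2 and so covers characteristic 2. *)
Lemma sum_antisym (V : zmodType) sigma (F : 'I_n -> 'I_n -> V) :
    (forall s t, s \in sigma -> t \in sigma -> s != t -> F t s = - F s t) ->
  \sum_(t in sigma) \sum_(s in sigma :\ t) F t s = 0.
Proof.
move=> Fanti.
have splitF t : t \in sigma -> \sum_(s in sigma :\ t) F t s =
    \sum_(s in sigma | (s < t)%N) F t s + \sum_(s in sigma | (t < s)%N) F t s.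
  move=> tsig; rewrite (bigID (fun s => (s < t)%N)) /=.
  by congr (_ + _); apply: eq_bigl => s; rewrite !inE -(inj_eq val_inj) /=;
    case: ltngtP; rewrite ?andbF ?andbT.
rewrite (eq_bigr _ splitF) big_split /=.
rewrite [X in _ + X](exchange_big_dep (fun s => s \in sigma)) /=; last by move=> t s _ /andP[].
rewrite -big_split big1 //= => t tsig.
rewrite [X in _ + X](eq_big (fun s => (s \in sigma) && (s < t)%N) (fun s => - F t s)).
- by rewrite sumrN addrN.
- by move=> s; rewrite tsig.
move=> s /andP[ssig /andP[_ st]]; rewrite Fanti ?opprK //.
by apply: contraTneq st => ->; rewrite ltnn.
Qed.

End Signs.

(** * Exactness of the Koszul complex on a set of variables *)

Section Koszul.
Variables (K : fieldType) (n : nat).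
Local Notation R := {mpoly K[n]}.
Implicit Types (A sigma tau : {set 'I_n}) (s t : 'I_n) (c : {set 'I_n} -> R).

(** A chain is kept as its coefficient function; this is the coefficient of e_tau in the
    differential of the sum of the c(sigma) e_sigma. The sign is the usual one, since alpha(tau; t)
    = alpha(tau + t; t) for t outside tau. *)
Definition koszul c tau : R :=
  \sum_(t | t \notin tau) (-1) ^+ alpha tau t * 'X_t * c (t |: tau).

(** With A as a support condition, all A share one differential, and the induction on A needs no
    inclusion or restriction maps. *)
Definition koszul_chain A (k : nat) c : Prop :=
  forall sigma, c sigma != 0 -> (sigma \subset A) && (#|sigma| == k).

(* In degree 0 this means that [c] dies in the augmentation R -> R/(x_t : t in A). *)
Definition koszul_cycle A (k : nat) c : Prop :=
  if k is 0 then var_ideal A (c set0) else forall tau, koszul c tau = 0.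

Lemma koszul_chain0 A k c sigma : koszul_chain A k c ->
  ~~ ((sigma \subset A) && (#|sigma| == k)) -> c sigma = 0.
Proof. by move=> cA; apply: contraNeq => /cA. Qed.

Lemma eq_koszul c c' : c =1 c' -> koszul c =1 koszul c'.
Proof. by move=> cc tau; apply: eq_bigr => t _; rewrite cc. Qed.

Lemma koszulD c c' tau :
  koszul (fun sigma => c sigma + c' sigma) tau = koszul c tau + koszul c' tau.
Proof. by rewrite -big_split; apply: eq_bigr => t _; rewrite mulrDr. Qed.

Lemma koszulN c tau : koszul (fun sigma => - c sigma) tau = - koszul c tau.
Proof. by rewrite -sumrN; apply: eq_bigr => t _; rewrite mulrN. Qed.

Lemma koszul_chain_koszul A k c : koszul_chain A k.+1 c -> koszul_chain A k (koszul c).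
Proof.
move=> cA tau; apply: contraR => tauN; rewrite /koszul big1 // => t tN.
rewrite (koszul_chain0 cA) ?mulr0 //; apply: contra tauN.
by rewrite subUset cardsU1 tN /= => /andP[/andP[_ ->] /eqP[/eqP]].
Qed.

Lemma koszulK c tau : koszul (koszul c) tau = 0.
Proof.
rewrite /koszul; under eq_bigr do rewrite big_distrr /=.
rewrite (eq_bigl (fun t => t \in ~: tau)) => [|t]; last by rewrite inE.
rewrite -[RHS](sum_antisym (sigma := ~: tau) (F := fun t s =>
  (-1) ^+ alpha tau t * 'X_t * ((-1) ^+ alpha (t |: tau) s * 'X_s * c (s |: (t |: tau))))).
  by apply: eq_bigr => t _; apply: eq_bigl => s; rewrite !inE negb_or.
move=> s t; rewrite !inE => sN tN st; rewrite setUCA.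
rewrite !mulrA [_ * 'X_t * _]mulrAC [in RHS](mulrAC _ 'X_s) (signU1_swap _ tN sN st).
by rewrite !mulNr [_ * 'X_t * 'X_s]mulrAC.
Qed.

(** Induction on |A|: the Koszul complex on A is the mapping cone of x_a on the one for B = A \ a,
    and x_a is a nonzerodivisor modulo (x_t : t in B). Taking a smallest in A keeps the signs
    uniform: alpha(tau; a) = 0 for tau in B, and inserting a raises every other alpha by one. *)
Lemma koszul_exact A k c : koszul_chain A k c -> koszul_cycle A k c ->
  exists2 b, koszul_chain A k.+1 b & koszul b =1 c.
Proof.
elim: {A}_.+1 {-2}A (ltnSn #|A|) k c => // N IHN A ltAN [|k] c cA.
  case/var_ideal_sum => q c0E.
  (* With c(emptyset) the sum of the q_t x_t, this is the chain whose coefficient at the singleton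
     of t is q_t. *)
  exists (fun sigma => \sum_(t in A | sigma == [set t]) q t).
    move=> sigma; apply: contraR => sN; rewrite big1 // => t /andP[tA /eqP sE].
    by move: sN; rewrite sE sub1set tA cards1.
  move=> tau; have [->|tau0] := eqVneq tau set0.
    rewrite c0E /koszul big_mkcond [RHS]big_mkcond; apply: eq_bigr => t _.
    rewrite inE /= setU0 /alpha (_ : [set s in set0 | _] = set0) ?cards0; last first.
      by apply/setP => s; rewrite !inE.
    rewrite mul1r; case: ifPn => tA; last first.
      rewrite big1 ?mulr0 // => s /andP[sA /eqP/set1_inj ts].
      by move: sA; rewrite -ts (negPf tA).
    rewrite (big_pred1 t) 1?mulrC // => s /=.
    rewrite (inj_eq set1_inj) eq_sym; case: eqP => [->|]; by rewrite ?tA ?andbF.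
  rewrite (koszul_chain0 cA) ?cards_eq0 ?(negPf tau0) ?andbF //.
  rewrite /koszul big1 // => t tN; rewrite big1 ?mulr0 // => s /andP[_ /eqP E].
  have: #|t |: tau| = 1%N by rewrite E cards1.
  by rewrite cardsU1 tN; case=> /eqP; rewrite cards_eq0 (negPf tau0).
rewrite /koszul_cycle => kc0; have [A0|[a0 a0A]] := set_0Vmem A.
  exists (fun=> 0) => [sigma|tau]; first by rewrite eqxx.
  rewrite (koszul_chain0 cA) ?A0 ?subset0; last first.
    by apply/negP => /andP[/eqP ->]; rewrite cards0.
  by rewrite /koszul big1 // => t _; rewrite mulr0.
pose a := [arg min_(i < a0 in A) (i : nat)].
have [aA amin] : a \in A /\ forall t, t \in A -> (a <= t)%N.
  by rewrite /a; case: arg_minnP.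
pose B := A :\ a.
have ltBN : (#|B| < N)%N by move: ltAN; rewrite (cardsD1 a A) aA.
have aNB : a \notin B by rewrite !inE eqxx.
have BA : B \subset A by apply: subD1set.
have BaN tau : tau \subset B -> a \notin tau.
  by move=> tB; apply: contraNN aNB => /(subsetP tB).
have alpha_a tau : tau \subset B -> alpha tau a = 0%N.
  move=> tB; apply/eqP; rewrite cards_eq0; apply/eqP/setP => t; rewrite !inE.
  apply/negbTE/andP => -[/(subsetP tB)/setD1P[_ /amin]].
  by rewrite ltnNge => ->.
have alpha_aU tau t : tau \subset B -> t \in B -> alpha (a |: tau) t = (alpha tau t).+1.
  move=> tB /setD1P[ta /amin]; rewrite alphaU1 ?BaN // leq_eqVlt => /orP[/eqP/val_inj E|->] //.
  by rewrite E eqxx in ta.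
(* Writing c = c0 + e_a ^ w with c0 and w free of e_a, w is a cycle over B (or, in
   degree 0, lies in (x_t : t in B)), say w = koszul v; then c + koszul (e_a ^ v)
   is a cycle over B. *)
pose w tau := if tau \subset B then c (a |: tau) else 0.
have wB : koszul_chain B k w.
  move=> tau; rewrite /w; case: ifPn => [tB|]; last by rewrite eqxx.
  by move/cA; rewrite cardsU1 BaN // add1n eqSS => /andP[].
have wcyc : koszul_cycle B k w.
  case: k => [|k] in cA wB *; rewrite /koszul_cycle.
    (* At the empty set, [koszul c = 0] says that x_a c({a}) is minus the sum of the x_t c({t}) over
       t in B; then x_a is cancelled modulo these x_t. *)
    apply: (var_ideal_prime aNB); rewrite /w sub0set setU0.
    have := kc0 set0; rewrite /koszul (bigD1 a) ?inE //= alpha_a ?sub0set // mul1r setU0.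
    move/eqP; rewrite addr_eq0 mulrC => /eqP ->; rewrite -sumrN.
    apply: ideal_gen_sum => t; rewrite inE /= setU0 => ta.
    have [tA|tNA] := boolP (t \in A); last first.
      rewrite (koszul_chain0 cA) ?sub1set ?(negPf tNA) // mulr0 oppr0.
      exact: ideal_gen0.
    rewrite mulrAC -mulNr; apply: ideal_genM; exists t => //.
    by rewrite !inE ta.
  move=> tau; have [tB|tNB] := boolP (tau \subset B); last first.
    by rewrite (koszul_chain0 (koszul_chain_koszul wB)) ?(negPf tNB).
  (* The coefficient of [koszul w] at tau is minus that of [koszul c] at tau with a added: moving
     past e_a costs one sign. *)
  apply/eqP; rewrite -oppr_eq0 -(kc0 (a |: tau)) /koszul -sumrN; apply/eqP.
  rewrite [LHS](bigD1 a) ?BaN //= {1}/w subUset sub1set (negPf aNB) mulr0 oppr0 add0r.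
  apply: eq_big => [t|t /andP[tN ta]]; first by rewrite !inE negb_or andbC.
  rewrite /w subUset sub1set tB andbT; case: ifPn => tBn.
    by rewrite alpha_aU // exprS mulN1r !mulNr setUCA.
  rewrite (koszul_chain0 cA) ?mulr0 ?oppr0 // !subUset !sub1set.
  by move: tBn; rewrite !inE ta /= => /negPf ->.
have [v vB vw] := IHN B ltBN k w wB wcyc.
pose b sigma := if a \in sigma then v (sigma :\ a) else 0.
have bA : koszul_chain A k.+2 b.
  move=> sigma; rewrite /b; case: ifP => [asig /vB|]; last by rewrite eqxx.
  rewrite (cardsD1 a sigma) asig => /andP[sB /eqP ->]; rewrite eqxx andbT.
  by rewrite -(setD1K asig) subUset sub1set aA (subset_trans sB).
have kb_a tau : a \in tau -> koszul b tau = - c tau.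
  move=> atau; have [tA|tNA] := boolP (tau \subset A); last first.
    rewrite (koszul_chain0 cA) ?(negPf tNA) // oppr0.
    by rewrite (koszul_chain0 (koszul_chain_koszul bA)) ?(negPf tNA).
  have tB : tau :\ a \subset B by apply: setSD.
  have -> : c tau = koszul v (tau :\ a) by rewrite vw /w tB setD1K.
  rewrite /koszul -sumrN [RHS](bigD1 a) /=; last by rewrite !inE eqxx.
  rewrite (koszul_chain0 vB) ?subUset ?sub1set ?(negPf aNB) // mulr0 oppr0 add0r.
  apply: eq_big => [t|t tN].
    by rewrite !inE; case: eqP => [->|]; rewrite ?atau ?andbT.
  have ta : t != a by apply: contraNneq tN => ->.
  have -> : b (t |: tau) = v (t |: (tau :\ a)).
    rewrite /b !inE atau orbT; congr v; apply/setP => s; rewrite !inE.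
    by case: (eqVneq s t) => [->|]; rewrite ?ta.
  have [tB'|tNB] := boolP (t \in B); last first.
    by rewrite (koszul_chain0 vB) ?subUset ?sub1set ?(negPf tNB) // !mulr0 oppr0.
  by rewrite -{1}(setD1K atau) alpha_aU // exprS mulN1r !mulNr.
pose c0 tau := c tau + koszul b tau.
have c0B : koszul_chain B k.+1 c0.
  move=> tau c0t; have aN : a \notin tau.
    by apply: contraNN c0t => atau; rewrite /c0 kb_a // addrN.
  have /andP[tA tk] : (tau \subset A) && (#|tau| == k.+1).
    apply: contraR c0t => tN; rewrite /c0 (koszul_chain0 cA) //.
    by rewrite (koszul_chain0 (koszul_chain_koszul bA)) // addr0.
  by rewrite tk subsetD1 tA aN.
have [|b0 b0B b0E] := IHN B ltBN k.+1 c0 c0B.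
  by move=> tau; rewrite koszulD kc0 koszulK addr0.
exists (fun sigma => b0 sigma + - b sigma).
  move=> sigma; apply: contraR => sN; rewrite (koszul_chain0 bA) // oppr0 addr0.
  rewrite (koszul_chain0 b0B) //; apply: contra sN => /andP[sB ->].
  by rewrite (subset_trans sB).
by move=> tau; rewrite koszulD koszulN b0E addrK.
Qed.

End Koszul.

(** * Coordinates and homogeneous elements of free modules *)

Section HomogeneousElements.
Variables (K : fieldType) (n : nat) (B : finType) (deg : B -> nat).
Implicit Types (v w : free_mod K n B) (p : {mpoly K[n]}).

Lemma fm_coordP v w : (forall b, fm_coord b v = fm_coord b w) -> v = w.
Proof. by move=> vw; apply/ffunP => b; apply: vw. Qed.

Lemma fm_coord_sum b (I : Type) (r : seq I) (P : pred I) (F : I -> free_mod K n B) :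
  fm_coord b (\sum_(i <- r | P i) F i) = \sum_(i <- r | P i) fm_coord b (F i).
Proof. exact: linear_sum. Qed.

Lemma fm_coordZ b p v : fm_coord b (p *: v) = p * fm_coord b v.
Proof. exact: linearZ. Qed.

Lemma fm_coordB b v w : fm_coord b (v - w) = fm_coord b v - fm_coord b w.
Proof. exact: linearB. Qed.

Lemma homog_elt0 e : homog_elt deg e (0 : free_mod K n B).
Proof. by move=> b m; rewrite linear0 msupp0. Qed.

Lemma homog_eltD e v w :
  homog_elt deg e v -> homog_elt deg e w -> homog_elt deg e (v + w).
Proof.
move=> ve we b m; rewrite linearD => /msuppD_le.
by rewrite mem_cat => /orP[/ve|/we].
Qed.

Lemma homog_eltN e v : homog_elt deg e v -> homog_elt deg e (- v).
Proof. by move=> ve b m; rewrite linearN (perm_mem (msuppN _)); apply: ve. Qed.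

Lemma homog_elt_sum e (I : Type) (r : seq I) (P : pred I) (F : I -> free_mod K n B) :
  (forall i, P i -> homog_elt deg e (F i)) -> homog_elt deg e (\sum_(i <- r | P i) F i).
Proof.
by move=> Fe; elim/big_rec: _ => [|i v Pi]; [apply: homog_elt0 | apply/homog_eltD/Fe].
Qed.

Lemma homog_eltZ e e' p v : (forall m, m \in msupp p -> (mdeg m + e' = e)%N) ->
  homog_elt deg e' v -> homog_elt deg e (p *: v).
Proof.
move=> pe ve b m; rewrite linearZ => /msuppM_le/allpairsP[[m1 m2] /= [m1p m2v ->]].
by rewrite mdegD -addnA (ve b m2 m2v) pe.
Qed.

End HomogeneousElements.

Lemma msupp_signX (K : fieldType) (n k : nat) (u m : 'X_{1..n}) :
  m \in msupp ((-1) ^+ k * 'X_[u] : {mpoly K[n]}) -> m = u.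
Proof.
rewrite -signr_odd; case: (odd k); rewrite ?expr0 ?expr1 ?mul1r ?mulN1r.
  by rewrite (perm_mem (msuppN _)) msuppX inE => /eqP.
by rewrite msuppX inE => /eqP.
Qed.

(** Regroups the four kinds of terms in d d f(sigma; u) for a fixed t: in the application the x and
    w terms are each symmetric in s and t, while the y and z terms are exchanged. *)
Lemma scaler_comb_sum (R : comPzRingType) (V : lmodType R) (I : Type) (r : seq I)
    (P : pred I) (a p q : R) (e f1 f2 h1 h2 : I -> R) (x y z w : I -> V) :
  a *: (p *: (\sum_(s <- r | P s) e s *: (f1 s *: x s - f2 s *: y s))
      - q *: (\sum_(s <- r | P s) e s *: (h1 s *: z s - h2 s *: w s)))
  = \sum_(s <- r | P s) (a * e s) *:
      ((p * f1 s) *: x s + (q * h2 s) *: w s - ((p * f2 s) *: y s + (q * h1 s) *: z s)).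
Proof.
rewrite !scaler_sumr -sumrB scaler_sumr; apply: eq_bigr => s _.
rewrite -[RHS]scalerA; congr (_ *: _).
rewrite !(scalerA _ (e s)) !(mulrC _ (e s)) -!scalerA -scalerBr; congr (_ *: _).
by rewrite !scalerBr !scalerA opprB opprD addrACA.
Qed.

(** * The differential and its coefficients *)

Section Resolution.
Variables (K : fieldType) (n : nat) (us : seq 'X_{1..n}).
Implicit Types (sigma tau : {set 'I_n}) (u w : 'X_{1..n}) (s t : 'I_n).

Local Notation B := (lq_basis K us).
Local Notation F i := (free_mod K n (B i)).
Local Notation symb := (lq_symb K us).
Local Notation g := (decomp K us).
Local Notation lset := (lqset K us).

Definition lq_index i sigma u := [&& u \in us, sigma \subset lset u & #|sigma| == i].

(** The right side of the boundary formula, for arbitrary sigma and u; only so can it be compared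
    with the convention f(sigma; u) = 0. In degree 0 it ignores sigma. *)
Definition lq_bdry i sigma u : F i :=
  match i return F i with
  | 0 => F0_elt us 'X_[u]
  | i'.+1 =>
    - \sum_(t in sigma)
        ((-1) ^+ alpha sigma t * 'X_t) *: symb i' (sigma :\ t) u
    + \sum_(t in sigma)
        ((-1) ^+ alpha sigma t * 'X_[((U_(t) + u) - g (U_(t) + u))%MM]) *:
          symb i' (sigma :\ t) (g (U_(t) + u)%MM)
  end.

Arguments lq_bdry : simpl never.

Definition lq_d i (v : F i.+1) : F i :=
  \sum_(b : B i.+1) fm_coord b v *: lq_bdry i (val b).1 (ssval (val b).2).

Fact lq_d_is_linear i : linear (@lq_d i).
Proof.
move=> a v w; rewrite /lq_d scaler_sumr -big_split; apply: eq_bigr => b _.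
by rewrite linearP scalerDl scalerA.
Qed.

HB.instance Definition _ i :=
  GRing.isLinear.Build {mpoly K[n]} (F i.+1) (F i) _ (@lq_d i) (@lq_d_is_linear i).

(* The coefficient of f(sigma; u), extended by 0 to all pairs (sigma, u). *)
Definition lq_coord i sigma u (v : F i.+1) : {mpoly K[n]}^o :=
  \sum_(b : B i.+1 | ((val b).1 == sigma) && (ssval (val b).2 == u)) fm_coord b v.

Fact lq_coord_is_linear i sigma u : linear (@lq_coord i sigma u).
Proof.
move=> a v w; rewrite /lq_coord scaler_sumr -big_split; apply: eq_bigr => b _.
by rewrite linearP.
Qed.

HB.instance Definition _ i sigma u :=
  GRing.isLinear.Build {mpoly K[n]} (F i.+1) {mpoly K[n]}^o _
    (@lq_coord i sigma u) (@lq_coord_is_linear i sigma u).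

Lemma lq_basis_index i (b : B i.+1) : lq_index i (val b).1 (ssval (val b).2).
Proof. by case: b => -[sigma [u uus]] /= /andP[/= su si]; rewrite /lq_index uus su. Qed.

Lemma lq_basis_inj i (b b' : B i.+1) :
  ((val b).1 == (val b').1) && (ssval (val b).2 == ssval (val b').2) = (b == b').
Proof.
apply/andP/eqP => [[/eqP eq1 /eqP/val_inj eq2]|->]; last by rewrite !eqxx.
by apply: val_inj; rewrite [LHS]surjective_pairing eq1 eq2 -surjective_pairing.
Qed.

Lemma lq_indexP i sigma u : lq_index i sigma u ->
  exists b : B i.+1, (val b).1 = sigma /\ ssval (val b).2 = u.
Proof.
case/and3P => uus su si.
have P : ((sigma, SeqSub uus).1 \subset lset (ssval (sigma, SeqSub uus).2))
         && (#|(sigma, SeqSub uus).1| == i) by rewrite /= su.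
by exists (Sub (sigma, SeqSub uus) P).
Qed.

Lemma lq_coord_basis i (b : B i.+1) (v : F i.+1) :
  lq_coord (val b).1 (ssval (val b).2) v = fm_coord b v.
Proof. by apply: big_pred1 => b'; apply: lq_basis_inj. Qed.

Lemma lq_coord0 i sigma u (v : F i.+1) : ~~ lq_index i sigma u -> lq_coord sigma u v = 0.
Proof.
move=> su; rewrite /lq_coord big_pred0 // => b; apply: contraNF su.
by case/andP=> /eqP <- /eqP <-; apply: lq_basis_index.
Qed.

Lemma lq_coordP i (v w : F i.+1) :
  (forall sigma u, lq_coord sigma u v = lq_coord sigma u w) -> v = w.
Proof. by move=> vw; apply: fm_coordP => b; rewrite -!lq_coord_basis vw. Qed.

Lemma lq_coord_symb i sigma u tau w :
  lq_coord sigma u (symb i tau w) = [&& lq_index i sigma u, sigma == tau & u == w]%:R.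
Proof.
have [/lq_indexP[b [<- <-]]|/lq_coord0->//] := boolP (lq_index i sigma u).
by rewrite lq_coord_basis /fm_coord ffunE.
Qed.

Lemma lq_symb0 i sigma u : ~~ lq_index i sigma u -> symb i sigma u = 0.
Proof.
move=> su; apply: lq_coordP => tau w; rewrite lq_coord_symb linear0.
by case: and3P => // -[+ /eqP tE /eqP wE]; rewrite tE wE (negPf su).
Qed.

Lemma lq_d_symb_index i sigma u :
  lq_index i sigma u -> lq_d (symb i sigma u) = lq_bdry i sigma u.
Proof.
case/lq_indexP => b [<- <-]; rewrite /lq_d (bigD1 b) //= [X in _ + X]big1.
  by rewrite addr0 /fm_coord ffunE !eqxx scale1r.
move=> b' /negPf b'b; rewrite /fm_coord ffunE.
by rewrite -lq_basis_inj in b'b; rewrite b'b scale0r.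
Qed.

Lemma lq_bdryS i sigma u : lq_bdry i.+1 sigma u =
  \sum_(t in sigma) (-1) ^+ alpha sigma t *:
    ('X_[(U_(t) + u - g (U_(t) + u))%MM] *: symb i (sigma :\ t) (g (U_(t) + u)%MM)
      - 'X_t *: symb i (sigma :\ t) u).
Proof.
rewrite /lq_bdry addrC -sumrB; apply: eq_bigr => t _.
move: (symb i _ _) (symb i _ _) => x y.
by rewrite scalerBr !scalerA.
Qed.

Lemma F0_eltE p : fm_coord (tt : B 0%N) (F0_elt us p : F 0) = p.
Proof. by rewrite /fm_coord ffunE. Qed.

Lemma F0_eq (v w : F 0) : fm_coord (tt : B 0%N) v = fm_coord (tt : B 0%N) w -> v = w.
Proof. by move=> vw; apply: fm_coordP => -[]. Qed.

Lemma F0_eltZ p q : p *: (F0_elt us q : F 0) = F0_elt us (p * q).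
Proof. by apply/ffunP => b; rewrite !ffunE. Qed.

Lemma lq_d_eps (w : F 1) :
  fm_coord (tt : B 0%N) (lq_d w) = \sum_(b : B 1%N) fm_coord b w * 'X_[ssval (val b).2].
Proof.
rewrite linear_sum; apply: eq_bigr => b _.
by rewrite linearZ /= [fm_coord tt _]F0_eltE.
Qed.

Lemma lq_dZ i a (x : F i.+1) : lq_d (a *: x) = a *: lq_d x.
Proof. exact: linearZ. Qed.

Lemma lq_dB i (x y : F i.+1) : lq_d (x - y) = lq_d x - lq_d y.
Proof. exact: linearB. Qed.

Lemma lq_d_comb i (a p q : {mpoly K[n]}) (x y : F i.+1) :
  lq_d (a *: (p *: x - q *: y)) = a *: (p *: lq_d x - q *: lq_d y).
Proof. by rewrite lq_dZ lq_dB !lq_dZ. Qed.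

Lemma lq_coord_lq_d i sigma u (v : F i.+2) : lq_coord sigma u (lq_d v) =
  \sum_(b : B i.+2)
    fm_coord b v * lq_coord sigma u (lq_bdry i.+1 (val b).1 (ssval (val b).2)).
Proof. by rewrite linear_sum; apply: eq_bigr => b _; apply: linearZ. Qed.

Lemma lq_coord_sum_symb i sigma u w (b : {set 'I_n} -> {mpoly K[n]}) :
  lq_coord sigma u (\sum_(tau : {set 'I_n}) b tau *: symb i tau w)
    = (lq_index i sigma u && (u == w))%:R * b sigma.
Proof.
have cZ tau : lq_coord sigma u (b tau *: symb i tau w)
    = b tau * [&& lq_index i sigma u, sigma == tau & u == w]%:R.
  by rewrite -lq_coord_symb; apply: linearZ.
rewrite linear_sum (eq_bigr _ (fun tau _ => cZ tau)) (bigD1 sigma) //= eqxx mulrC.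
by rewrite big1 ?addr0 // => tau /negPf; rewrite eq_sym => ->; rewrite andbF mulr0.
Qed.

Lemma lq_coord_comb i sigma u (a p q : {mpoly K[n]}) (x y : F i.+1) :
  lq_coord sigma u (a *: (p *: x - q *: y))
    = a * (p * lq_coord sigma u x - q * lq_coord sigma u y).
Proof.
have cZ b z : lq_coord sigma u (b *: z) = b * lq_coord sigma u z by exact: linearZ.
have cB z z' : lq_coord sigma u (z - z') = lq_coord sigma u z - lq_coord sigma u z'.
  exact: linearB.
by rewrite cZ cB !cZ.
Qed.

(** * The boundary formula on all symbols, and d d = 0 *)

Hypotheses (us_uniq : uniq us) (us_lq : linear_quotients K us).
Hypothesis g_regular : regular_decomp K us.

(* Regularity makes the boundary formula consistent with the convention f(sigma; u) = 0:
   for t outside set(u) one has g(x_t u) = u and the two t-terms cancel. *)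
Lemma lq_bdry0 i sigma u :
  u \in us -> ~~ lq_index i.+1 sigma u -> lq_bdry i.+1 sigma u = 0.
Proof.
move=> uus; rewrite /lq_index uus /= negb_and => su.
rewrite lq_bdryS big1 // => t tsig.
have symb_t w : ~~ ((sigma :\ t \subset lset w) && (#|sigma| == i.+1)) ->
    symb i (sigma :\ t) w = 0.
  move=> sw; rewrite lq_symb0 // /lq_index; apply: contra sw => /and3P[_ ->].
  by rewrite (cardsD1 t sigma) tsig.
have [gus _ gu] := decomp_lqset us_uniq us_lq t uus.
case: ifPn gu => [tu _|tu /eqP ->]; last first.
  by rewrite addmK subrr scaler0.
(* Either sigma has the wrong size, or, as t is in set(u), sigma \ t still has an element outside
   set(u). In both cases the symbols at u and at g(x_t u) vanish, the latter by regularity. *)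
have st w : lset w \subset lset u ->
    ~~ ((sigma :\ t \subset lset w) && (#|sigma| == i.+1)).
  move=> wu; rewrite negb_and; case/orP: su => [su|->]; last by rewrite orbT.
  apply/orP; left; apply: contra su => sw.
  by rewrite -(setD1K tsig) subUset sub1set tu (subset_trans sw).
by rewrite !symb_t ?st // ?g_regular // !scaler0 subrr scaler0.
Qed.

(** Lets d be applied a second time without asking which symbols are basis elements. The degree 0
    analogue fails for nonempty sigma, where the symbol is 0 but [lq_bdry] gives u. *)
Lemma lq_d_symb i sigma u : u \in us -> lq_d (symb i.+1 sigma u) = lq_bdry i.+1 sigma u.
Proof.
move=> uus; have [/lq_d_symb_index//|su] := boolP (lq_index i.+1 sigma u).
by rewrite lq_symb0 // linear0 lq_bdry0.
Qed.

(** For singletons both terms are sent to x_t u. In higher degree the terms for the pair (t, s) form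
    [G t s] times two signs; [G] is symmetric by [decomp_swap], and the product of signs is
    antisymmetric. *)
Lemma lq_d_bdry i sigma u : u \in us -> lq_d (lq_bdry i.+1 sigma u) = 0.
Proof.
move=> uus; have gus t := decomp_lqset us_uniq us_lq t uus.
rewrite lq_bdryS linear_sum /=; case: i => [|i].
  rewrite big1 // => t _; rewrite lq_d_comb.
  have [gu gle _] := gus t.
  have dE w : w \in us ->
      lq_d (symb 0 (sigma :\ t) w) = (sigma :\ t == set0)%:R *: F0_elt us 'X_[w].
    move=> wus; case: eqP => [->|/eqP st0].
      by rewrite lq_d_symb_index ?scale1r // /lq_index wus sub0set cards0.
    by rewrite lq_symb0 ?linear0 ?scale0r // /lq_index cards_eq0 (negPf st0) !andbF.
  rewrite !dE //; move: (_ == _)%:R => e.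
  rewrite ![_ *: (e *: _)]scalerA !(mulrC _ e) -!scalerA !F0_eltZ.
  by rewrite -!mpolyXD submK // subrr scaler0.
pose h t s := g (U_(s) + g (U_(t) + u))%MM.
pose c t := 'X_[(U_(t) + u - g (U_(t) + u))%MM] : {mpoly K[n]}.
pose G t s := ('X_[(U_(s) + (U_(t) + u) - h t s)%MM] : {mpoly K[n]})
      *: symb i (sigma :\ t :\ s) (h t s)
    + ('X_t * 'X_s) *: symb i (sigma :\ t :\ s) u
    - ((c t * 'X_s) *: symb i (sigma :\ t :\ s) (g (U_(t) + u)%MM)
       + ('X_t * c s) *: symb i (sigma :\ t :\ s) (g (U_(s) + u)%MM)).
have GC t s : G t s = G s t.
  have hC : h t s = h s t by apply: decomp_swap.
  have sD : sigma :\ t :\ s = sigma :\ s :\ t by rewrite !setDDl setUC.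
  have sU : (U_(s) + (U_(t) + u) = U_(t) + (U_(s) + u))%MM.
    by rewrite !addmA (addmC U_(s)%MM).
  rewrite /G hC sD sU (mulrC 'X_t 'X_s).
  generalize (symb i (sigma :\ s :\ t) (g (U_(s) + u)%MM)) => x.
  generalize (symb i (sigma :\ s :\ t) (g (U_(t) + u)%MM)) => y.
  by rewrite (mulrC 'X_t (c s)) (mulrC 'X_s (c t)) (addrC (_ *: y)).
transitivity (\sum_(t in sigma) \sum_(s in sigma :\ t)
    ((-1) ^+ alpha sigma t * (-1) ^+ alpha (sigma :\ t) s : {mpoly K[n]}) *: G t s).
  apply: eq_bigr => t tsig; have [gu gle _] := gus t.
  rewrite lq_d_comb !lq_d_symb // !lq_bdryS scaler_comb_sum.
  apply: eq_bigr => s _; rewrite /G /c.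
  (* The two quotients telescope: (x_t u / g(x_t u)) (x_s g(x_t u) / h) = x_s x_t u / h, which is
     symmetric once h is. *)
  have <- : c t * 'X_[(U_(s) + g (U_(t) + u) - h t s)%MM]
      = 'X_[(U_(s) + (U_(t) + u) - h t s)%MM].
    rewrite -mpolyXD addmBA; last by have [] := decomp_lqset us_uniq us_lq s gu.
    by rewrite addmA (addmC _ U_(s)%MM) -addmA submK.
  by [].
apply: sum_antisym => s t ssig tsig st.
by rewrite GC signD1_swap // scaleNr.
Qed.

Lemma lq_dd i (v : F i.+2) : lq_d (lq_d v) = 0.
Proof.
rewrite {2}/lq_d linear_sum big1 // => b _; rewrite linearZ /=.
have /and3P[uus _ _] := lq_basis_index b.
by rewrite lq_d_bdry // scaler0.
Qed.

(** * The filtration by generators, and exactness *)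

(** Only the first sum of the boundary formula survives: g(x_t u) precedes u, whereas w does not. *)
Lemma lq_coord_bdry i sigma u tau w :
    lq_index i.+1 sigma u -> lq_index i tau w -> (index u us <= index w us)%N ->
  lq_coord tau w (lq_bdry i.+1 sigma u) =
    - ((u == w)%:R * \sum_(t in sigma | sigma :\ t == tau) (-1) ^+ alpha sigma t * 'X_t).
Proof.
case/and3P => uus su _ tw uw; have wus : w \in us by case/and3P: tw.
rewrite lq_bdryS linear_sum /= big_mkcondr /= big_distrr -sumrN.
apply: eq_bigr => t tsig; rewrite lq_coord_comb !lq_coord_symb tw /=.
have [gus _] := decomp_lqset us_uniq us_lq t uus.
rewrite (subsetP su) // => gu.
have -> : (w == g (U_(t) + u)%MM) = false.
  by apply: contraTF gu => /eqP <-; rewrite -leqNgt.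
rewrite andbF !mulr0 sub0r mulrN [tau == _]eq_sym [w == u]eq_sym.
by case: ifP => _; case: (u == w); rewrite ?mulr0 ?mulr1 ?mul1r ?mul0r.
Qed.

Lemma lq_coord_chain i u (v : F i.+1) :
  koszul_chain (lset u) i (fun sigma => lq_coord sigma u v).
Proof.
by move=> sigma; apply: contraR => su; rewrite lq_coord0 // /lq_index (negPf su) andbF.
Qed.

(* [lq_fil j] is the span of the f(sigma; u) with u among the first j generators. *)
Definition lq_fil (j : nat) i (v : F i.+1) : Prop :=
  forall sigma u, (j <= index u us)%N -> lq_coord sigma u v = 0.

Lemma lq_coord_d (j i : nat) (v : F i.+2) tau w :
    w \in us -> lq_fil j.+1 v -> (j <= index w us)%N ->
  lq_coord tau w (lq_d v) = - koszul (fun sigma => lq_coord sigma w v) tau.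
Proof.
move=> wus vj jw; have [tw|tw] := boolP (lq_index i tau w); last first.
  rewrite lq_coord0 // (koszul_chain0 (koszul_chain_koszul (@lq_coord_chain i.+1 w v))) ?oppr0 //.
  by move: tw; rewrite /lq_index wus.
have -> : koszul (fun sigma => lq_coord sigma w v) tau = \sum_(t | t \notin tau)
    \sum_(b : B i.+2 | ((val b).1 == t |: tau) && (ssval (val b).2 == w))
      (-1) ^+ alpha tau t * 'X_t * fm_coord b v.
  by apply: eq_bigr => t _; rewrite big_distrr.
rewrite lq_coord_lq_d [in RHS](exchange_big_dep xpredT) //= -[in RHS]sumrN.
apply: eq_bigr => b _.
have [bw|wb] := leqP (index (ssval (val b).2) us) (index w us); last first.
  rewrite -lq_coord_basis vj ?(leq_ltn_trans jw) // mul0r big1 ?oppr0 // => t.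
  by rewrite mulr0.
rewrite lq_coord_bdry ?lq_basis_index // mulrN; congr (- _).
case: eqP => [_|_]; last by rewrite mul0r mulr0 big_pred0 // => t; rewrite !andbF.
rewrite mul1r mulrC big_distrl /=; apply: eq_big => [t|t /andP[tb /eqP <-]].
  rewrite andbT; apply/andP/andP => -[].
    by move=> tb /eqP <-; rewrite setD11 setD1K.
  by move=> tN /eqP ->; rewrite setU11 setU1K.
by rewrite -[in alpha (val b).1 _](setD1K tb) alphaU1 ?setD11 // ltnn.
Qed.

(** In positive degree this is [lq_coord_d]. In degree 0, solving d v = 0 for the term of the last
    generator u puts coefficient times u into the ideal of the earlier generators, so the
    coefficient lies in the colon ideal, generated by the variables of set(u). *)
Lemma lq_fil_leading j i (v : F i.+1) : (j < size us)%N -> lq_fil j.+1 v -> lq_d v = 0 ->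
  koszul_cycle (lset (nth 0%MM us j)) i (fun sigma => lq_coord sigma (nth 0%MM us j) v).
Proof.
move=> ltj vj dv0; set u := nth 0%MM us j.
have uus : u \in us by apply: mem_nth.
have uj : index u us = j by apply: index_uniq.
case: i => [|i] in v vj dv0 *; last first.
  by move=> tau; apply/eqP; rewrite -oppr_eq0 -(lq_coord_d tau uus vj) ?uj // dv0 linear0.
rewrite /koszul_cycle; apply/var_idealP => m mv; apply/(lqsetP us_lq m uus).
have : mon_ideal (fun w => (w \in us) && (index w us < index u us)%N)
    (lq_coord set0 u v * 'X_[u] : {mpoly K[n]}).
  have: fm_coord (tt : B 0%N) (lq_d v) = 0 by rewrite dv0 linear0.
  rewrite lq_d_eps (bigID (fun b : B 1%N => ssval (val b).2 == u)) /= => /eqP.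
  have -> : \sum_(b : B 1%N | ssval (val b).2 == u) fm_coord b v * 'X_[ssval (val b).2]
      = lq_coord set0 u v * 'X_[u].
    rewrite /lq_coord big_distrl; apply: eq_big => [b|b /eqP -> //].
    have /and3P[_ _] := lq_basis_index b.
    by rewrite cards_eq0 => ->.
  rewrite addr_eq0 => /eqP ->; rewrite -sumrN; apply: ideal_gen_sum => b bu.
  rewrite -mulNr; have [ub|bj] := leqP (index u us) (index (ssval (val b).2) us).
    rewrite -lq_coord_basis vj ?oppr0 ?mul0r; first exact: ideal_gen0.
    rewrite ltn_neqAle -uj ub andbT; apply: contraNneq bu => E.
    by apply/eqP; apply: (index_inj u _ uus (esym E)); case/and3P: (lq_basis_index b).
  apply: ideal_genM; exists (ssval (val b).2) => //.
  by rewrite bj; case/and3P: (lq_basis_index b) => ->.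
by move/mon_idealMX/(_ m mv) => [w /andP[wus wu] wm]; exists w; rewrite // wu.
Qed.

Lemma lq_fil_step j i (v : F i.+1) : (j < size us)%N -> lq_fil j.+1 v -> lq_d v = 0 ->
  exists w : F i.+2, lq_fil j (v - lq_d w).
Proof.
move=> ltj vj dv0; set u := nth 0%MM us j.
have uus : u \in us by apply: mem_nth.
have uj : index u us = j by apply: index_uniq.
have [b bA bE] := koszul_exact (@lq_coord_chain i u v) (lq_fil_leading ltj vj dv0).
(* The minus sign compensates the one in [lq_coord_d]. *)
pose w : F i.+2 := \sum_(sigma : {set 'I_n}) - b sigma *: symb i.+1 sigma u.
have wE sigma u' : lq_coord sigma u' w = - ((u' == u)%:R * b sigma).
  rewrite lq_coord_sum_symb mulrN; have [->|_] := eqVneq u' u; last by rewrite andbF !mul0r.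
  rewrite andbT; case: (boolP (lq_index _ _ _)) => // su.
  by rewrite (koszul_chain0 bA) ?mulr0 //; move: su; rewrite /lq_index uus.
have wj : lq_fil j.+1 w.
  move=> sigma u' ju'; rewrite wE (_ : u' == u = false) ?mul0r ?oppr0 //.
  by apply: contraTF ju' => /eqP ->; rewrite uj ltnn.
exists w => tau u' ju'.
have -> : lq_coord tau u' (v - lq_d w) = lq_coord tau u' v - lq_coord tau u' (lq_d w).
  exact: linearB.
have [u'us|u'N] := boolP (u' \in us); last by rewrite !lq_coord0 ?subrr // /lq_index (negPf u'N).
rewrite (lq_coord_d tau u'us wj ju') (eq_koszul (wE^~ u')) koszulN opprK.
have [->|u'u] := eqVneq u' u.
  rewrite (eq_koszul (c' := b)) => [|sigma]; last by rewrite mul1r.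
  by rewrite bE subrr.
rewrite [koszul _ _]big1 => [|t _]; last by rewrite mul0r mulr0.
rewrite subr0; apply: vj; rewrite ltn_neqAle ju' andbT -uj.
by apply: contraNneq u'u => E; apply/eqP; apply: (index_inj u u'us uus (esym E)).
Qed.

Lemma lq_fil_exact j i (v : F i.+1) : lq_fil j v -> lq_d v = 0 -> exists w : F i.+2, v = lq_d w.
Proof.
elim: j v => [|j IHj] v vj dv0.
  by exists 0; rewrite linear0; apply: lq_coordP => sigma u; rewrite vj ?linear0.
have [ltj|gej] := ltnP j (size us); last first.
  apply: IHj => // sigma u ju; rewrite lq_coord0 // /lq_index -index_mem.
  by rewrite ltnNge (leq_trans gej).
have [w wj] := lq_fil_step ltj vj dv0.
have [|w' w'E] := IHj _ wj; first by rewrite lq_dB dv0 lq_dd subrr.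
by exists (w + w'); rewrite linearD /= -w'E addrC subrK.
Qed.

Lemma lq_exact i (v : F i.+1) : lq_d v = 0 <-> exists w : F i.+2, v = lq_d w.
Proof.
split=> [|[w ->]]; last exact: lq_dd.
apply: (@lq_fil_exact (size us)) => sigma u us_u; rewrite lq_coord0 // /lq_index.
by rewrite -index_mem ltnNge us_u.
Qed.

(** * Grading and minimality *)

Lemma lq_symb_homog i sigma u :
  homog_elt (@lq_deg K n us i.+1) (#|sigma| + mdeg u)%N (symb i sigma u).
Proof.
move=> b m; rewrite /fm_coord ffunE; case: andP => [[/eqP <- /eqP <-]|_].
  by rewrite msupp1 inE => /eqP ->; rewrite mdeg0.
by rewrite msupp0.
Qed.

Lemma lq_bdry_homog i sigma u : lq_index i sigma u ->
  homog_elt (@lq_deg K n us i) (#|sigma| + mdeg u)%N (lq_bdry i sigma u).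
Proof.
case/and3P => uus _ si; case: i si => [|i] si.
  by move=> [] m; rewrite F0_eltE msuppX inE (eqP si) addn0 => /eqP ->.
have sD t : t \in sigma -> #|sigma| = #|sigma :\ t|.+1.
  by move=> tsig; rewrite (cardsD1 t) tsig.
rewrite /lq_bdry; apply: homog_eltD.
  apply/homog_eltN/homog_elt_sum => t tsig.
  apply: (homog_eltZ _ (@lq_symb_homog _ _ _)) => m /msupp_signX ->.
  by rewrite mdeg1 (sD t).
apply: homog_elt_sum => t tsig.
apply: (homog_eltZ _ (@lq_symb_homog _ _ _)) => m /msupp_signX ->.
have [_ gle _] := decomp_lqset us_uniq us_lq t uus.
rewrite addnCA -mdegD submK // mdegD mdeg1 (sD t) //.
by rewrite addnA addn1.
Qed.

Lemma lq_d_homog i e (v : F i.+1) :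
  homog_elt (@lq_deg K n us i.+1) e v -> homog_elt (@lq_deg K n us i) e (lq_d v).
Proof.
move=> ve; apply: homog_elt_sum => b _.
exact: (homog_eltZ (ve b) (@lq_bdry_homog _ _ _ (lq_basis_index b))).
Qed.

Hypothesis us_min : forall u w, u \in us -> w \in us -> (u <= w)%MM -> u = w.
Hypothesis us_neq0 : 0%MM \notin us.

(** No coefficient of the boundary formula is a unit: u is not 1, and x_t u / g(x_t u) = 1 would
    make x_t u a minimal generator properly divisible by the generator u. *)
Lemma lq_d_minimal i (v : F i.+1) b : var_ideal [set: 'I_n] (fm_coord b (lq_d v)).
Proof.
have -> : fm_coord b (lq_d v) = \sum_(b' : B i.+1)
    fm_coord b' v * fm_coord b (lq_bdry i (val b').1 (ssval (val b').2)).
  by rewrite fm_coord_sum; apply: eq_bigr => b' _; rewrite fm_coordZ.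
apply: ideal_gen_sum => b' _.
have /and3P[uus su _] := lq_basis_index b'.
move: (val b').1 (ssval _) uus su => sigma u uus su.
apply: ideal_genMl; case: i b {b' v} => [|i] b.
  case: b; rewrite F0_eltE; apply: var_idealX_setT.
  by apply: contraNneq us_neq0 => <-.
rewrite lq_bdryS fm_coord_sum; apply: ideal_gen_sum => t tsig.
have [gus gle gu] := decomp_lqset us_uniq us_lq t uus.
have Xm m (x : F i.+1) : m != 0%MM -> var_ideal [set: 'I_n] (fm_coord b ('X_[m] *: x)).
  by move=> m0; rewrite fm_coordZ mulrC; apply/ideal_genMl/var_idealX_setT.
rewrite fm_coordZ fm_coordB -(mulN1r (fm_coord _ _)); apply/ideal_genMl/ideal_genD; last first.
  by apply/ideal_genMl/Xm; rewrite -mdeg_eq0 mdeg1.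
apply: Xm; apply: contraTneq tsig => E; move: gus gu.
have -> : g (U_(t) + u)%MM = (U_(t) + u)%MM by rewrite -[RHS](submK gle) E add0m.
move=> tus; have /(us_min uus tus) tu := lem_addl U_(t)%MM u.
have /(congr1 (@mdeg n))/eqP := tu; rewrite mdegD mdeg1 add1n.
by rewrite eqn_leq ltnn andbF.
Qed.

End Resolution.

(** * Assembly of the resolution *)

Theorem theorem1p12 (K : fieldType) (n : nat) (I : {mpoly K[n]} -> Prop)
    (us : seq 'X_{1..n})
    (I_monomial : monomial_ideal I)
    (I_proper : ~ I 1)
    (us_gens : enum_min_gens I us)
    (us_lq : linear_quotients K us)
    (g_regular : regular_decomp K us) :
  let g := decomp K us in
  exists d : forall i, {linear free_mod K n (lq_basis K us i.+1) ->
                               free_mod K n (lq_basis K us i)},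
    [/\ forall u : 'X_{1..n}, u \in us ->
          d 0%N (lq_symb K us 0 set0 u) = F0_elt us 'X_[u],
        forall (i : nat) (sigma : {set 'I_n}) (u : 'X_{1..n}),
          u \in us -> sigma \subset lqset K us u -> #|sigma| = i.+1 ->
          d i.+1 (lq_symb K us i.+1 sigma u) =
            - \sum_(t in sigma)
                ((-1) ^+ alpha sigma t * 'X_t) *: lq_symb K us i (sigma :\ t) u
            + \sum_(t in sigma)
                ((-1) ^+ alpha sigma t * 'X_[((U_(t) + u) - g (U_(t) + u))%MM]) *:
                  lq_symb K us i (sigma :\ t) (g (U_(t) + u)%MM)
      & minimal_graded_free_resolution I (@lq_deg K n us) d
          (fm_coord (tt : lq_basis K us 0))].
Proof.
move=> g; have [us_uniq Ius _] := us_gens.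
have us_min := min_gens_antichain us_gens.
(* The exponent 0 is the monomial 1; as a generator it would put 1 into I. *)
have us_neq0 : 0%MM \notin us.
  apply/negP => us0; apply: I_proper; apply/Ius; rewrite -mpolyX0.
  by apply/mon_idealX; exists 0%MM => //; apply: lepm_refl.
exists (fun i => @lq_d K n us i); split.
- by move=> u uus; apply: lq_d_symb_index; rewrite /lq_index uus sub0set cards0.
- by move=> i sigma u uus su si; apply: lq_d_symb_index; rewrite /lq_index uus su si eqxx.
split.
- move=> e v ve; apply/dhomogP => m mv.
  by rewrite -(ve tt m mv) /= addn0.
- exact: lq_d_homog.
- by move=> p; exists (F0_elt us p); rewrite /= F0_eltE subrr; apply/Ius/ideal_gen0.
- move=> v; split=> [/Ius vI|[w ->]]; last first.
    rewrite /= lq_d_eps; apply/Ius/ideal_gen_sum => b _; apply: ideal_genM.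
    by exists (ssval (val b).2) => //; case/and3P: (lq_basis_index b).
  (* Passing to the only coordinate of F_0 makes this a claim about a polynomial of I, open to
     induction on membership; a u is the image of a f(emptyset; u). *)
  suff [w E] : exists w : free_mod K n (lq_basis K us 1),
      fm_coord (tt : lq_basis K us 0) v = fm_coord (tt : lq_basis K us 0) (lq_d w).
    by exists w; apply: F0_eq.
  elim/ideal_gen_ind: vI => [|a _ q [u uus ->] [w ->]].
    by exists 0; rewrite !linear0.
  exists (a *: lq_symb K us 0 set0 u + w).
  have lq_u : lq_index K us 0 set0 u by rewrite /lq_index uus sub0set cards0.
  have -> : lq_d (a *: lq_symb K us 0 set0 u + w) = F0_elt us (a * 'X_[u]) + lq_d w.
    by rewrite linearD /= lq_dZ lq_d_symb_index // [lq_bdry _ _ _]/lq_bdry F0_eltZ.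
  rewrite [RHS]linearD /= F0_eltE //.
- move=> i v; exact: lq_exact.
- move=> i v b; exact: lq_d_minimal.
Qed.
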